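(* Let $n\ge 2$ and $\Re\in\{\mathbb{Q},\mathbb{R},\mathbb{C}\}$. 1) Let $W$ be the set of all words $w\in M_n$, including $\epsilon$, such that $w_1\ne a_1$ and $w_{fin}\ne a_1$. Then the set $B=\{\widehat{p_w}\mid w\in W\}$ is a basis of $\widehat{C}(M_n)$. 2) Let $\bar W'$ be the set of all reduced words $w\in F_n$, including $\epsilon$, such that $w_1\ne a_1$, $w_1w_2\ne a_2a_1^{-1}$, $w_{fin}\ne a_1^{-1}$ and $w_{fin-1}w_{fin}\ne a_1a_2^{-1}$. Let $\bar W=\bar W'\cup\{a_1^{-1}\}\setminus\{a_2\}$. Then the set $\bar B=\{\widehat{p_w}\mid w\in\bar W\}$ is a basis of $\widehat{C}(F_n)$. 3) Let $W_{Br}'=\bar W\cup\{a_1,a_2\}\setminus\{\epsilon\}$, with $\bar W$ as defined in 2), and let $W_{Br}$ be a subset of $W_{Br}'$ such that $|\{w,w^{-1}\}\cap W_{Br}|=1$ for every $w\in W_{Br}'$. Then $B_{Br}=\{\widehat{\phi_w}\mid w\in W_{Br}\}$ is a basis of $\widehat{Br}(F_n)$.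
   Context: Words. Let $S=\{a_1,\dots,a_n\}$ be a finite set of letters, $n\ge 2$. $M_n$ is the free monoid: the set of all finite words over $S$, including the empty word $\epsilon$. Let $\bar S=\{a_i,a_i^{-1}\mid 1\le i\le n\}$, with $(a_i^{-1})^{-1}=a_i$. $F_n$ is the free group, viewed as the set of all reduced words over $\bar S$ (words with no subword $a_ia_i^{-1}$ or $a_i^{-1}a_i$), including $\epsilon$. $|w|$ is the length of $w$, $w_i$ its $i$-th letter, $w_{fin}=w_{|w|}$ its last letter and $w_{fin-1}=w_{|w|-1}$. The inverse of a reduced word is $w^{-1}=w_{fin}^{-1}\cdots w_1^{-1}$. Conditions on letters that do not exist (such as conditions on $w_1w_2$ when $|w|\le 1$) are vacuously satisfied. Counting functions. For words $v,w$ in $M_n$ (resp. reduced words $v,w$ in $F_n$) with $v\ne\epsilon$, $p_v(w)$ is the number of indices $i$ with $v=w_iw_{i+1}\cdots w_{i+|v|-1}$ (occurrences of $v$ as a contiguous subword, overlaps allowed); $p_\epsilon(w)=|w|$. $C(M_n)$ (resp. $C(F_n)$) is the $\Re$-vector space of all finite $\Re$-linear combinations of the functions $p_v$, regarded as functions $M_n\to\Re$ (resp. $F_n\to\Re$). Quotients. Two functions are equivalent, $f_1\sim f_2$, if $\|f_1-f_2\|_\infty<\infty$. $\widehat f$ denotes the equivalence class of $f$, and $\widehat{C}(M_n)$ (resp. $\widehat{C}(F_n)$) is the quotient vector space of $C(M_n)$ (resp. $C(F_n)$) by $\sim$, i.e. by its subspace of bounded functions. Brooks space. For $w\in F_n$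 with $|w|\ge1$ the Brooks quasimorphism is $\phi_w=p_w-p_{w^{-1}}$. $Br(F_n)$ is the $\Re$-vector space of all finite $\Re$-linear combinations of the $\phi_w$, and $\widehat{Br}(F_n)$ is the quotient of $Br(F_n)$ by $\sim$, i.e. by its subspace of bounded functions; $\widehat{\phi_w}$ is the class of $\phi_w$. *)

(* Defs.v *)
From HB Require Import structures.
From mathcomp Require Import all_boot all_order all_algebra.
From mathcomp Require Import all_classical reals.
From mathcomp Require Import complex.

Set Implicit Arguments.
Unset Strict Implicit.
Unset Printing Implicit Defensive.

Import Order.TTheory GRing.Theory Num.Theory.
Local Open Scope classical_set_scope.
Local Open Scope ring_scope.
Local Open Scope quotient_scope.

Variant scalars := ScalarQ | ScalarR | ScalarC.

Definition scalar_field (R : realType) (k : scalars) : numFieldType :=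
  match k with
  | ScalarQ => rat
  | ScalarR => R
  | ScalarC => R[i]
  end.

Section LinearAlgebra.
Variables (K : numFieldType) (V : lmodType K).

Definition lin_span (G : set V) : set V :=
  [set v | exists2 s : seq (K * V), forall x, x \in s -> G x.2 &
           v = \sum_(x <- s) x.1 *: x.2].

Definition lin_indep (B : set V) : Prop :=
  forall (s : seq V) (c : V -> K),
    uniq s -> (forall x, x \in s -> B x) ->
    \sum_(x <- s) c x *: x = 0 -> forall x, x \in s -> c x = 0.

Definition is_basis (B : set V) : Prop := lin_indep B /\ lin_span B = setT.

(* The set {b w | w in W} is a basis, as an indexed set: distinct indices in W
   give distinct basis vectors. *)
Definition is_indexed_basis (I : Type) (W : set I) (b : I -> V) : Prop :=
  set_inj W b /\ is_basis [set b w | w in W].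

Variable G : set V.

Lemma lin_span_gen v : G v -> lin_span G v.
Proof.
move=> Gv; exists [:: (1, v)] => [x|]; first by rewrite inE => /eqP ->.
by rewrite big_seq1 scale1r.
Qed.

Lemma lin_span0 : lin_span G 0.
Proof. by exists [::]; rewrite ?big_nil. Qed.

Definition span_pred : {pred V} := fun v => `[< lin_span G v >].

Lemma span_pred_closed : submod_closed span_pred.
Proof.
split; first exact/asboolP/lin_span0.
move=> a u v /asboolP[s sG ->] /asboolP[t tG ->]; apply/asboolP.
exists ([seq (a * x.1, x.2) | x <- s] ++ t) => [x|].
  by rewrite mem_cat => /orP[/mapP[y /sG ys ->]|/tG].
rewrite big_cat big_map /= scaler_sumr; congr (_ + _).
by apply: eq_bigr => x _; rewrite scalerA.
Qed.

HB.instance Definition _ :=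
  GRing.isSubmodClosed.Build K V span_pred span_pred_closed.

Definition span_space := {v : V | v \in span_pred}.

HB.instance Definition _ := SubChoice.on span_space.
HB.instance Definition _ :=
  [SubChoice_isSubLmodule of span_space by <:].

Definition to_span (v : V) (Gv : lin_span G v) : span_space :=
  exist _ v (asboolT Gv).

End LinearAlgebra.

Section QuotientModule.
Variables (K : numFieldType) (V : lmodType K).

Definition submod_pred (U : {pred V}) (Ucl : submod_closed U) : {pred V} := U.

HB.instance Definition _ (U : {pred V}) (Ucl : submod_closed U) :=
  GRing.isSubmodClosed.Build K V (submod_pred Ucl) Ucl.

Variables (U : {pred V}) (Ucl : submod_closed U).

Definition lquot := Quotient.quot (submod_pred Ucl).

HB.instance Definition _ := GRing.Zmodule.on lquot.
HB.instance Definition _ := EqQuotient.on lquot.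

Definition lquot_proj (v : V) : lquot := \pi_(lquot) v.

Definition lquot_scale (a : K) (x : lquot) : lquot :=
  lquot_proj (a *: (repr (x : lquot))).

Lemma lquot_projE (u v : V) : lquot_proj u = lquot_proj v <-> u - v \in submod_pred Ucl.
Proof.
rewrite /lquot_proj; split => [|uv].
  by move=> /eqP; rewrite -Quotient.idealrBE.
by apply/eqP; rewrite -Quotient.idealrBE.
Qed.

Lemma lquot_projD (u v : V) :
  lquot_proj (u + v) = lquot_proj u + lquot_proj v.
Proof. exact: (raddfD (\pi_(lquot))). Qed.

Lemma lquot_proj_surj (x : lquot) : exists v, x = lquot_proj v.
Proof.
by exists (repr (x : lquot)); rewrite /lquot_proj reprK.
Qed.

Lemma lquot_projZ (a : K) (v : V) :
  lquot_proj (a *: v) = lquot_scale a (lquot_proj v).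
Proof.
apply/lquot_projE; rewrite -scalerBr rpredZ//.
by apply/lquot_projE; rewrite /lquot_proj reprK.
Qed.

Fact lquot_scaleA (a b : K) (x : lquot) :
  lquot_scale a (lquot_scale b x) = lquot_scale (a * b) x.
Proof. by have [v ->] := lquot_proj_surj x; rewrite -!lquot_projZ scalerA. Qed.

Fact lquot_scale1 : left_id 1 lquot_scale.
Proof.
by move=> x; have [v ->] := lquot_proj_surj x; rewrite -lquot_projZ scale1r.
Qed.

Fact lquot_scaleDr : right_distributive lquot_scale +%R.
Proof.
move=> a x y; have [u ->] := lquot_proj_surj x.
have [v ->] := lquot_proj_surj y.
by rewrite -lquot_projD -!lquot_projZ -lquot_projD scalerDr.
Qed.

Fact lquot_scaleDl (x : lquot) :
  {morph lquot_scale^~ x : a b / a + b}.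
Proof.
move=> a b; have [v ->] := lquot_proj_surj x.
by rewrite -!lquot_projZ -lquot_projD scalerDl.
Qed.

HB.instance Definition _ := GRing.Zmodule_isLmodule.Build K lquot
  lquot_scaleA lquot_scale1 lquot_scaleDr lquot_scaleDl.

End QuotientModule.

Section FunctionsModuloBounded.
Variables (K : numFieldType) (T : Type) (G : set (T -> K^o)).

Definition bounded_pred : {pred span_space G} :=
  fun f => `[< exists M : K, forall t : T, `|\val f t| <= M >].

Lemma bounded_pred_closed : submod_closed bounded_pred.
Proof.
split; first by apply/asboolP; exists 0 => t; rewrite /= normr0.
move=> a f g /asboolP[M fM] /asboolP[N gN]; apply/asboolP.
exists (`|a| * M + N) => t /=; apply: (le_trans (ler_normD _ _)).
apply: lerD; last exact: gN.
rewrite -[leLHS]/(`|a * \val f t|) normrM.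
exact: ler_wpM2l.
Qed.

Definition hat_space : lmodType K := lquot bounded_pred_closed.

Definition hat (f : T -> K^o) (Gf : lin_span G f) : hat_space :=
  lquot_proj bounded_pred_closed (to_span Gf).

Lemma hat_eqP (f g : T -> K^o) (Gf : lin_span G f) (Gg : lin_span G g) :
  hat Gf = hat Gg <-> exists M : K, forall t : T, `|f t - g t| <= M.
Proof. by rewrite /hat lquot_projE; split => /asboolP. Qed.

End FunctionsModuloBounded.

(* Every index counts when v = [::], so occ [::] w = size w: see occ0. *)
Definition occ (L : eqType) (v w : seq L) : nat :=
  #|[set i : 'I_(size w) | prefix v (drop i w)]%SET|.

Lemma occ0 (L : eqType) (w : seq L) : occ [::] w = size w.
Proof.
rewrite /occ -[RHS]card_ord -cardsT; congr #|pred_of_set _|.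
by apply/setP => i; rewrite !inE prefix0s.
Qed.

Section FreeMonoid.
Variables (K : numFieldType) (n : nat).

Definition monoid_word := seq 'I_n.

Definition pM (v : monoid_word) : monoid_word -> K^o :=
  fun w => (occ v w)%:R.

Definition hatC_M : lmodType K := hat_space (range pM).

Definition hat_pM (w : monoid_word) : hatC_M :=
  hat (lin_span_gen (imageP pM (I : setT w))).

End FreeMonoid.

Section FreeGroup.
Variables (K : numFieldType) (n : nat).

(* (i, false) is the letter a_i and (i, true) its inverse. *)
Definition letter : Type := ('I_n * bool)%type.
HB.instance Definition _ := Finite.on letter.

Definition letter_inv (x : letter) : letter := (x.1, ~~ x.2).

Lemma letter_invK : involutive letter_inv.
Proof. by case=> i b; rewrite /letter_inv /= negbK. Qed.

Definition reduced (w : seq letter) : bool :=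
  sorted (fun x y => y != letter_inv x) w.

Record group_word := GroupWord {
  gword :> seq letter;
  gword_reduced : reduced gword }.

HB.instance Definition _ := [isSub for gword].
HB.instance Definition _ := [Choice of group_word by <:].

Lemma reduced_inv (w : group_word) : reduced (rev (map letter_inv w)).
Proof.
rewrite /reduced rev_sorted sorted_map.
have := gword_reduced w; rewrite /reduced => /sub_sorted; apply => x y /=.
by rewrite letter_invK eq_sym.
Qed.

Definition winv (w : group_word) : group_word := GroupWord (reduced_inv w).

Definition empty_gword : group_word := @GroupWord [::] isT.
Definition letter_gword (x : letter) : group_word := @GroupWord [:: x] isT.

Definition pF (v : group_word) : group_word -> K^o := fun w => (occ v w)%:R.

Definition hatC_F : lmodType K := hat_space (range pF).

Definition hat_pF (w : group_word) : hatC_F :=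
  hat (lin_span_gen (imageP pF (I : setT w))).

Definition brooks (w : group_word) : group_word -> K^o := pF w - pF (winv w).

Definition brooks_gen : set (group_word -> K^o) :=
  [set brooks w | w in [set w : group_word | (0 < size w)%N]].

Definition hatBr : lmodType K := hat_space brooks_gen.

(* Stated for all w, as brooks empty_gword = 0. *)
Lemma brooks_span (w : group_word) : lin_span brooks_gen (brooks w).
Proof.
have [w0|w0] := posnP (size w); last by apply: lin_span_gen; exists w.
rewrite (_ : brooks w = 0); first exact: lin_span0.
rewrite /brooks (_ : winv w = w) ?subrr//.
by apply: val_inj => /=; rewrite (size0nil w0).
Qed.

Definition hat_brooks (w : group_word) : hatBr := hat (brooks_span w).

End FreeGroup.

Section BasisWords.
Variable n : nat.

(* The conditions w_1 <> a, w_fin <> a, ... fail exactly when w has a prefix or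
   suffix of the given form; they hold when w is too short. *)
Definition W_M (a1 : 'I_n) : set (monoid_word n) :=
  [set w | ~~ prefix [:: a1] w /\ ~~ suffix [:: a1] w].

Definition W_F' (a1 a2 : letter n) : set (group_word n) :=
  [set w | [/\ ~~ prefix [:: a1] w,
               ~~ prefix [:: a2; letter_inv a1] w,
               ~~ suffix [:: letter_inv a1] w &
               ~~ suffix [:: a1; letter_inv a2] w]].

Definition W_F (a1 a2 : letter n) : set (group_word n) :=
  (W_F' a1 a2 `|` [set letter_gword (letter_inv a1)])
    `\` [set letter_gword a2].

Definition W_Br' (a1 a2 : letter n) : set (group_word n) :=
  (W_F a1 a2 `|` [set letter_gword a1; letter_gword a2])
    `\` [set empty_gword n].

End BasisWords.

(* Main.v *)
Require Import Defs.
From mathcomp Require Import all_boot all_order all_algebra.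
From mathcomp Require Import all_classical reals.
From mathcomp Require Import complex zify.

Set Implicit Arguments.
Unset Strict Implicit.
Unset Printing Implicit Defensive.

Import Order.TTheory GRing.Theory Num.Theory.
Local Open Scope classical_set_scope.
Local Open Scope card_scope.

(** Write [f ~ g] when [f - g] is bounded and [p_v] for the function counting
    occurrences of [v]. Everything rests on two observations.

    Spanning. Each occurrence of [v] in a word, except one at the very start,
    extends in exactly one way to an occurrence of [x v] for a letter [x]; hence
    [p_v ~ \sum_x p_(x v)], and symmetrically [p_v ~ \sum_x p_(v x)]
    ([occ_extl], [occ_extr]). So any one letter [l] may be eliminated in front
    of [v]: [p_(l v)] is a combination of [p_v] and of the [p_(x v)] with
    [x <> l] ([spanned_pivotl]). In the free monoid the eliminated letter is
    [a_1] on both sides, and induction on the length concludes. In the free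
    group [a_1] cannot precede [v] when [v] starts with [a_1^-1], and then [a_2]
    is eliminated instead; this is where the two-letter conditions come from. In
    words of length at least 3 the conditions on the two ends concern different
    pairs of letters, so the ends can be treated one after the other. The
    relations among words of length at most 2 are not independent: the sum of
    all left extensions of letters equals the sum of all right extensions. What
    they give on letters is [p_eps ~ \sum_x p_x] and one relation that
    expresses [p_(a_1) + p_(a_1^-1)] by [p_eps] and words of length 2; they
    remove [a_1] and [a_2] ([spanned_a1], [spanned_size1]).

    Independence. Let [g] be a bounded combination of counting functions [p_w]
    of words [w] of length at most [N]. No word that does not start with [a] can
    begin inside a block [a^N] and run past its end, nor begin before the block
    and run past its end, as it is too short; dually for words that do not end
    with [b] and a block [b^N]. So [g] is additive across such blocks, and on
        [b^N z a^N v b^N z a^N v ... b^N z a^N]      (with [k] copies of [v])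
    it equals [(k + 1) C + k g(v)] with [C = g(b^N z a^N)]. Boundedness forces
    [C + g(v) = 0] ([weighted_count_padded]). In the monoid take [a = b = a_1]
    and [z] empty, so that [C = 0] and [g] vanishes on all words; a shortest
    word with nonzero coefficient then gives a contradiction. In the free group
    take [a = a_1], [b = a_1^-1], [z = a_2]. Now [v] must neither start with
    [a_1^-1] nor end with [a_1]; a word [w] violating this is shielded by a
    letter [a_2] in front or [a_2^-1] behind, and the two-letter conditions say
    that shielding creates no further occurrence of an index word of length at
    least 2 ([occ_pad_left], [occ_pad_right]). Choosing [v = a_2] shows [C = 0],
    as [a_2] is not in the index set. The words [eps] and [a_1^-1], to which the
    padding argument does not apply, are dealt with beforehand by evaluating on
    powers of [a_1] and of [a_1^-1].

    Brooks functions. The operator taking [f] to [f - f \o winv] preserves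
    boundedness and maps [p_w] to [phi_w], so spanning follows from the case of
    [C(F_n)]. A combination of Brooks functions is a combination of counting
    functions with coefficients odd under inversion; its values at [a_2] and
    [a_2^-1] are opposite, which again gives [C = 0]. *)

(** * Occurrences of a word *)

Section Occurrences.
Local Open Scope nat_scope.
Variable L : finType.
Implicit Types (v w x y : seq L) (a b : L).

Lemma occ_nil v : occ v [::] = 0.
Proof. by apply/eqP; rewrite -leqn0 (leq_trans (max_card _)) ?card_ord. Qed.

Lemma occ_cons v a w : occ v (a :: w) = prefix v (a :: w) + occ v w.
Proof.
rewrite /occ -!sum1_card !big_mkcond /= big_ord_recl.
rewrite inE drop0; congr (_ + _); rewrite [RHS]big_mkcond /=.
by apply: eq_bigr => i _; rewrite !inE.
Qed.

Lemma prefix_rconsE v w a :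
  prefix v (rcons w a) = prefix v w + (v == rcons w a) :> nat.
Proof.
elim: w v => [|b w IH] [|c v] //=.
by rewrite eqseq_cons; case: eqP => //= _; rewrite IH.
Qed.

Lemma suffix_consE v w a :
  suffix v (a :: w) = suffix v w + (v == a :: w) :> nat.
Proof.
by rewrite /suffix rev_cons prefix_rconsE -rev_cons (inj_eq (can_inj revK)).
Qed.

Lemma occ_rcons v w a : occ v (rcons w a) = occ v w + suffix v (rcons w a).
Proof.
elim: w => [|b w IH] /=.
  rewrite occ_cons !occ_nil addn0 /suffix !prefixs1.
  by congr nat_of_bool; rewrite !(can2_eq revK revK).
rewrite !occ_cons IH -rcons_cons prefix_rconsE /= suffix_consE; lia.
Qed.

Lemma occ_rev v w : occ (rev v) (rev w) = occ v w.
Proof.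
elim: w => [|a w IH]; first by rewrite !occ_nil.
by rewrite rev_cons occ_rcons IH occ_cons -rev_cons suffix_rev addnC.
Qed.

Lemma occ_map (f : L -> L) v w : injective f ->
  occ (map f v) (map f w) = occ v w.
Proof.
move=> fI; have pre : forall v w, prefix (map f v) (map f w) = prefix v w.
  by elim=> [|b {}v IH] [|c {}w] //=; rewrite IH (inj_eq fI).
by elim: w => [|a w IH] /=; rewrite ?occ_nil // !occ_cons IH -map_cons pre.
Qed.

Lemma occ_small v w : size w < size v -> occ v w = 0.
Proof.
elim: w => [|a w IH] /= vw; first exact: occ_nil.
rewrite occ_cons IH 1?ltnW // addn0.
case: prefixP => // -[s e]; move: vw.
by rewrite -[(size w).+1]/(size (a :: w)) e size_cat ltnNge leq_addr.
Qed.

Lemma occ_eq_size v w : 0 < size v -> size w <= size v -> occ v w = (v == w).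
Proof.
case: w => [|a w] v0 sw; first by rewrite occ_nil; case: v v0 {sw}.
rewrite occ_cons occ_small // addn0; congr nat_of_bool.
apply/idP/eqP => [|->]; last exact: prefix_refl.
move=> /prefixP[[|b s] e]; first by rewrite e cats0.
by move: sw; rewrite e size_cat /=; lia.
Qed.

(** The correction term accounts for an occurrence at the very start, which has
    no left extension; it is absent for the empty word, whose occurrences are
    the positions of letters, all of them extended by that letter. *)
Lemma occ_extl v w :
  occ v w = \sum_(a : L) occ (a :: v) w + ((v != [::]) && prefix v w).
Proof.
elim: w => [|b w IH].
  rewrite occ_nil big1 => [|a _]; last exact: occ_nil.
  by case: v.
rewrite occ_cons IH; under [in RHS]eq_bigr do rewrite occ_cons.
rewrite big_split /= [X in _ = X + _ + _](bigD1 b) //= eqxx /=.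
rewrite (@big1 _ _ _ _ _ (fun i => i != b)) => [|c /negPf-> //].
case: v {IH} => [|d v]; first by rewrite prefix0s /= !addn0.
by rewrite addn0 addnC -addnA addnCA addnA.
Qed.

Lemma occ_extr v w :
  occ v w = \sum_(a : L) occ (rcons v a) w + ((v != [::]) && suffix v w).
Proof.
rewrite -occ_rev occ_extl; congr (_ + (_ && _)).
  by apply: eq_bigr => a _; rewrite -rev_rcons occ_rev.
by rewrite -[in RHS](inj_eq (can_inj revK)).
Qed.

(** An occurrence of [v] across the boundary between [a ^ N] and [y] would start
    inside the block, hence with [a], or else be longer than [N]. *)
Lemma occ_cat_padl a v x y N : 0 < size v <= N -> ~~ prefix [:: a] v ->
  occ v (x ++ nseq N a ++ y) = occ v (x ++ nseq N a) + occ v y.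
Proof.
move=> /andP[v0 vN] va.
elim: x => [|b x IH] /=.
  (* The block contains no starting point of an occurrence. *)
  have H M z : occ v (nseq M a ++ z) = occ v z.
    elim: M => [|M IH] //.
    rewrite -[nseq M.+1 a ++ z]/(a :: nseq M a ++ z) occ_cons IH.
    case: v va v0 {vN IH} => //= c v.
    by rewrite prefix0s andbT eq_sym => /negPf ->.
  by rewrite H -[nseq N a]cats0 H occ_nil.
rewrite !occ_cons IH addnA; congr (nat_of_bool _ + _ + _).
rewrite -!cat_cons.
rewrite catA !prefixE takel_cat // size_cat size_nseq.
by rewrite (leq_trans vN) // leq_addl.
Qed.

Lemma occ_cat_padr b v x y N : 0 < size v <= N -> ~~ suffix [:: b] v ->
  occ v (x ++ nseq N b ++ y) = occ v x + occ v (nseq N b ++ y).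
Proof.
move=> vN vb; rewrite -occ_rev !rev_cat rev_nseq -catA.
rewrite occ_cat_padl ?size_rev //.
by rewrite -[in LHS](rev_nseq N b) -rev_cat !occ_rev addnC.
Qed.

Lemma occ_nseq_head a v k :
  v != [::] -> ~~ prefix [:: a] v -> occ v (nseq k a) = 0.
Proof.
case: v => // b v _; rewrite /= prefix0s andbT eq_sym => ba.
elim: k => [|k IH]; first exact: occ_nil.
by rewrite -[nseq _ _]/(a :: nseq k a) occ_cons IH /= (negPf ba).
Qed.

Lemma occ_nseq_last a v k :
  v != [::] -> ~~ suffix [:: a] v -> occ v (nseq k a) = 0.
Proof.
move=> v0 va; rewrite -(rev_nseq k a) -[v]revK occ_rev occ_nseq_head //.
by rewrite -size_eq0 size_rev size_eq0.
Qed.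

Lemma occ_letter_power a k : occ [:: a] (nseq k a) = k.
Proof.
elim: k => [|k IH]; first exact: occ_nil.
by rewrite -[nseq _ _]/(a :: nseq k a) occ_cons IH /= prefix0s eqxx.
Qed.
End Occurrences.

(** * Bases of a space of functions modulo bounded functions *)

Section SpansModuloBounded.
Local Open Scope ring_scope.
Variables (K : numFieldType) (T : Type).
Implicit Types f g h : T -> K^o.

Definition bounded_fun f := exists M : K, forall t, `|f t| <= M.

Lemma bounded_fun0 : bounded_fun 0.
Proof. by exists 0 => t; rewrite normr0. Qed.

Lemma bounded_funZD (a : K) f g :
  bounded_fun f -> bounded_fun g -> bounded_fun (a *: f + g).
Proof.
move=> [M fM] [N gN]; exists (`|a| * M + N) => t.
rewrite (le_trans (ler_normD _ _)) // lerD //.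
by rewrite -[leLHS]/(`|a * f t|) normrM ler_wpM2l.
Qed.

Lemma bounded_funB f g : bounded_fun f -> bounded_fun g -> bounded_fun (f - g).
Proof.
by move=> bf bg; rewrite addrC -scaleN1r; apply: bounded_funZD.
Qed.

Variables (I : choiceType) (b : I -> T -> K^o) (W : set I).

Definition span_mod f :=
  exists2 h, lin_span [set b w | w in W] h & bounded_fun (f - h).

Lemma span_mod_gen w : W w -> span_mod (b w).
Proof.
move=> Ww; exists (b w); first by apply: lin_span_gen; exists w.
by rewrite subrr; apply: bounded_fun0.
Qed.

Lemma span_mod_bounded f : bounded_fun f -> span_mod f.
Proof. by move=> bf; exists 0; [apply: lin_span0|rewrite subr0]. Qed.

Lemma span_modZD (a : K) f g :
  span_mod f -> span_mod g -> span_mod (a *: f + g).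
Proof.
move=> [h hW fh] [k kW gk]; exists (a *: h + k).
  have [_ cl] := @span_pred_closed K _ [set b w | w in W].
  by apply/asboolP/cl; apply/asboolP.
have -> : a *: f + g - (a *: h + k) = a *: (f - h) + (g - k).
  by rewrite scalerBr opprD addrACA.
exact: bounded_funZD.
Qed.

Lemma span_mod0 : span_mod 0.
Proof. exact/span_mod_bounded/bounded_fun0. Qed.

Lemma span_modZ (a : K) f : span_mod f -> span_mod (a *: f).
Proof. by move=> fW; rewrite -[_ *: _]addr0; apply: span_modZD (span_mod0). Qed.

Lemma span_modD f g : span_mod f -> span_mod g -> span_mod (f + g).
Proof. by rewrite -{2}[f]scale1r; apply: span_modZD. Qed.

Lemma span_modN f : span_mod f -> span_mod (- f).
Proof. by rewrite -scaleN1r; apply: span_modZ. Qed.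

Lemma span_mod_sum (J : Type) (r : seq J) (P : pred J) (F : J -> T -> K^o) :
  (forall j, P j -> span_mod (F j)) -> span_mod (\sum_(j <- r | P j) F j).
Proof.
by move=> h; elim/big_ind: _ => //; [apply: span_mod0|apply: span_modD].
Qed.

Lemma span_mod_congr f g : bounded_fun (f - g) -> span_mod g -> span_mod f.
Proof. by move=> /span_mod_bounded fg /(span_modD fg); rewrite subrK. Qed.

Definition indep_mod := forall (s : seq I) (c : I -> K),
  uniq s -> (forall w, w \in s -> W w) ->
  bounded_fun (\sum_(w <- s) c w *: b w) -> forall w, w \in s -> c w = 0.

(** Independence and spanning up to bounded error can be checked on functions,
    without mentioning the quotient space. *)
Lemma indep_span_mod_basis (G : set (T -> K^o))
    (Gb : forall w, lin_span G (b w)) :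
  indep_mod -> (forall g, G g -> span_mod g) ->
  is_indexed_basis W (fun w => hat (Gb w)).
Proof.
move=> ind spn.
pose p := lquot_proj (@bounded_pred_closed K T G).
have pD u v : p (u + v) = p u + p v by apply: lquot_projD.
have pZ a v : p (a *: v) = a *: p v by apply: lquot_projZ.
have p0 : p 0 = 0 by have := pZ 0 0; rewrite !scale0r.
have pE f g (Gf : lin_span G f) (Gg : lin_span G g) :
  bounded_fun (f - g) -> hat Gf = hat Gg by move=> fg; apply/hat_eqP.
(* Combinations of classes are classes of combinations. *)
have psum (J : Type) (r : seq J) (c : J -> K) (i : J -> I) :
    exists Gs : lin_span G (\sum_(j <- r) c j *: b (i j)),
      \sum_(j <- r) c j *: hat (Gb (i j)) = hat Gs.
  have e : \sum_(j <- r) c j *: hat (Gb (i j)) =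
      p (\sum_(j <- r) c j *: to_span (Gb (i j))).
    by elim/big_rec2: _ => [|j x y _ ->]; rewrite ?p0 // pD pZ.
  have v : \val (\sum_(j <- r) c j *: to_span (Gb (i j))) =
      \sum_(j <- r) c j *: b (i j).
    by rewrite raddf_sum; apply: eq_bigr.
  have Gs : lin_span G (\sum_(j <- r) c j *: b (i j)).
    by rewrite -v; case: (\sum_(j <- r) _) => f Gf; apply/asboolP.
  by exists Gs; rewrite e; congr p; apply: val_inj.
(* Here the indices, not the vectors, are assumed distinct: this also yields
   the injectivity of the family. *)
have ind' (s : seq I) (c : I -> K) : uniq s -> (forall w, w \in s -> W w) ->
    \sum_(w <- s) c w *: hat (Gb w) = 0 -> forall w, w \in s -> c w = 0.
  move=> us sW s0; apply: ind => //.
  have [Gs e] := psum _ s c id; move: s0; rewrite e.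
  have -> : 0 = hat (lin_span0 G).
    by rewrite -p0; congr p; apply: val_inj.
  by move=> /hat_eqP[M Mh]; exists M => t; move: (Mh t); rewrite subr0.
have inj : set_inj W (fun w => hat (Gb w)).
  move=> v w /set_mem Wv /set_mem Ww e; apply/eqP/negPn/negP => vw.
  have := ind' [:: v; w] (fun x => if x == v then 1 else -1).
  rewrite /= inE vw => /(_ isT).
  rewrite !big_cons big_nil eqxx eq_sym (negPf vw).
  rewrite e scale1r scaleN1r addr0 subrr => h.
  have /h/(_ erefl v) : forall x, x \in [:: v; w] -> W x.
    by move=> x; rewrite !inE => /orP[]/eqP->.
  by rewrite inE eqxx => /(_ isT)/eqP; rewrite oner_eq0.
split=> //; split.
  move=> s c us sB.
  have [r [Wr sE]] : exists r, (forall w, w \in r -> W w) /\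
      s = [seq hat (Gb w) | w <- r].
    elim: s sB {us} => [|x s IH] sB; first by exists [::].
    have [w Ww e] := sB x (mem_head _ _).
    have [|r [rW ->]] := IH.
      by move=> y ys; apply: sB; rewrite inE ys orbT.
    exists (w :: r); rewrite /= e; split=> // y.
    by rewrite inE => /orP[/eqP->//|/rW].
  move: us; rewrite sE big_map => /map_uniq ur r0 x /mapP[w wr ->].
  exact: (ind' r (fun w => c (hat (Gb w)))).
apply/seteqP; split=> // x _; have [v ->] := lquot_proj_surj x.
case: v => f Gf; have /asboolP Gf' := Gf.
have -> : lquot_proj (@bounded_pred_closed K T G) (exist _ f Gf) = hat Gf'.
  by congr p; apply: val_inj.
have [h hW fh] : span_mod f.
  have [s sG ->] := Gf'; rewrite big_seq; apply: span_mod_sum => j js.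
  by apply/span_modZ/spn/sG.
have [s sW hs] := hW.
have [r [rW {}hs]] : exists r : seq (K * I), (forall x, x \in r -> W x.2) /\
    h = \sum_(x <- r) x.1 *: b x.2.
  rewrite hs; elim: s sW {hs} => [|y s IH] sW.
    by exists [::]; rewrite !big_nil.
  have [w Ww e] := sW y (mem_head _ _).
  have [|r [rW re]] := IH; first by move=> z zs; apply: sW; rewrite inE zs orbT.
  exists ((y.1, w) :: r); rewrite !big_cons /= e re; split=> // z.
  by rewrite inE => /orP[/eqP->//|/rW].
have [Gs e] := psum _ r fst snd.
exists [seq (x.1, hat (Gb x.2)) | x <- r].
  by move=> _ /mapP[y /rW Wy ->]; exists y.2.
by rewrite big_map /= e; apply: pE; rewrite -hs.
Qed.

End SpansModuloBounded.

(** * Counting functions: elimination of a letter and padding *)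

(** The fields [rat], [R] and [R[i]] all have this property; in a general
    [numFieldType] a function of nonzero slope could be bounded. *)
Definition archimedean_norm (K : numFieldType) :=
  forall x M : K, (forall k : nat, `|x| *+ k <= M)%R -> x = 0%R.

Section CountingFunctions.
Local Open Scope ring_scope.
Variables (K : numFieldType) (L : finType) (T : choiceType) (tw : T -> seq L).

(** The word [v] ranges over all sequences, even when [T] is the type of reduced
    words: a sequence that is not reduced gives the zero function, so the
    extension relations can be summed over all letters in both cases. *)
Definition count_fun (v : seq L) : T -> K^o := fun t => (occ v (tw t))%:R.

Lemma bounded_count_ext (v : seq L) (F : L -> seq L) (P : seq L -> bool) :
  (forall w, occ v w = (\sum_a occ (F a) w + P w)%N) ->
  bounded_fun (count_fun v - \sum_a count_fun (F a)).
Proof.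
move=> ext; exists 1 => t.
have -> : (count_fun v - \sum_a count_fun (F a)) t =
    (occ v (tw t))%:R - \sum_a (occ (F a) (tw t))%:R :> K.
  by rewrite fctE; congr (_ - _); rewrite fct_sumE.
rewrite ext natrD natr_sum addrC addKr.
by case: (P _); rewrite ?normr1 // normr0.
Qed.

Variable W : set T.
Let spanned v := span_mod (fun w => count_fun (tw w)) W (count_fun v).

(** One term of an extension relation is expressed by all the others. *)
Lemma spanned_pivot (v : seq L) (F : L -> seq L) (a : L) :
  bounded_fun (count_fun v - \sum_x count_fun (F x)) ->
  spanned v -> (forall x, x != a -> spanned (F x)) -> spanned (F a).
Proof.
move=> ext vW FW.
apply: (@span_mod_congr _ _ _ _ _ _
  (count_fun v - \sum_(x | x != a) count_fun (F x))); last first.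
  by apply: span_modD => //; apply/span_modN/span_mod_sum.
have -> : count_fun (F a) - (count_fun v - \sum_(x | x != a) count_fun (F x)) =
    0 - (count_fun v - \sum_x count_fun (F x)).
  by rewrite [in RHS](bigD1 a) //= sub0r !opprB addrA.
by apply: bounded_funB => //; apply: bounded_fun0.
Qed.

Lemma spanned_pivotl v a :
  spanned v -> (forall x, x != a -> spanned (x :: v)) -> spanned (a :: v).
Proof. exact/spanned_pivot/bounded_count_ext/occ_extl. Qed.

Lemma spanned_pivotr v a :
  spanned v -> (forall x, x != a -> spanned (rcons v x)) -> spanned (rcons v a).
Proof. exact/spanned_pivot/bounded_count_ext/occ_extr. Qed.

Lemma spanned_gen w : W w -> spanned (tw w).
Proof. exact: span_mod_gen. Qed.

(** The combination of counting functions as a function of arbitrary sequences,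
    which can be split and concatenated without proofs of reducedness. *)
Definition weighted_count (s : seq T) (c : T -> K) (u : seq L) : K :=
  \sum_(w <- s) c w * (occ (tw w) u)%:R.

Lemma weighted_countE s c t :
  weighted_count s c (tw t) = (\sum_(w <- s) c w *: count_fun (tw w)) t.
Proof. by rewrite fct_sumE. Qed.

Variables (s : seq T) (c : T -> K).
Hypothesis arch : archimedean_norm K.
Hypothesis bnd : bounded_fun (\sum_(w <- s) c w *: count_fun (tw w)).

(** A bounded function that is affine in [k] along a family of words is constant
    there. *)
Lemma weighted_count_slope (u : nat -> seq L) (x y : K) :
  (forall k, exists t, tw t = u k) ->
  (forall k, weighted_count s c (u k) = x *+ k + y) -> x = 0.
Proof.
have [M Mb] := bnd; move=> tu ux; apply: (arch (M := M + `|y|)) => k.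
rewrite -normrMn -[x *+ k](addrK y) (le_trans (ler_normB _ _)) // lerD2r.
by have [t e] := tu k; rewrite -ux -e weighted_countE.
Qed.

Lemma coef_eq0_of_slope (w0 : T) (u : nat -> seq L) : uniq s -> w0 \in s ->
  (forall k, exists t, tw t = u k) ->
  (forall w k, w \in s -> c w != 0 -> occ (tw w) (u k) = ((w == w0) * k)%N) ->
  c w0 = 0.
Proof.
move=> us w0s tu uk; apply: (weighted_count_slope (y := 0) tu) => k.
rewrite /weighted_count (bigD1_seq w0) //= big_seq_cond big1 ?addr0 ?addr0.
  have [->|c0] := eqVneq (c w0) 0; first by rewrite mul0r mul0rn.
  by rewrite uk // eqxx mul1n mulr_natr.
move=> w /andP[ws /negPf ww0].
have [->|c0] := eqVneq (c w) 0; first by rewrite mul0r.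
by rewrite uk // ww0 mulr0.
Qed.

Section Padding.
Variables (a b : L) (z : seq L) (N : nat).
Hypothesis sN : forall w, w \in s -> c w != 0 ->
  [/\ (0 < size (tw w) <= N)%N, ~~ prefix [:: a] (tw w)
    & ~~ suffix [:: b] (tw w)].

Lemma weighted_count_padl x y : weighted_count s c (x ++ nseq N a ++ y) =
  weighted_count s c (x ++ nseq N a) + weighted_count s c y.
Proof.
rewrite /weighted_count -big_split /= !big_seq; apply: eq_bigr => w ws.
rewrite -mulrDr -natrD; have [->|c0] := eqVneq (c w) 0; first by rewrite !mul0r.
by have [wN wa _] := sN ws c0; rewrite occ_cat_padl.
Qed.

Lemma weighted_count_padr x y : weighted_count s c (x ++ nseq N b ++ y) =
  weighted_count s c x + weighted_count s c (nseq N b ++ y).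
Proof.
rewrite /weighted_count -big_split /= !big_seq; apply: eq_bigr => w ws.
rewrite -mulrDr -natrD; have [->|c0] := eqVneq (c w) 0; first by rewrite !mul0r.
by have [wN _ wb] := sN ws c0; rewrite occ_cat_padr.
Qed.

Definition pad : seq L := nseq N b ++ z ++ nseq N a.

(** [pad v pad v ... v pad], with [k] copies of [v]. *)
Definition padded (v : seq L) (k : nat) : seq L :=
  iter k (fun y => pad ++ v ++ y) pad.

(** The count is additive across the blocks of [a] in front of [v] and of [b]
    behind it, so each further copy of [pad ++ v] adds the same amount. *)
Lemma weighted_count_padded v : (forall k, exists t, tw t = padded v k) ->
  weighted_count s c pad + weighted_count s c v = 0.
Proof.
move=> tu; apply: (weighted_count_slope (y := weighted_count s c pad) tu).
elim=> [|k IH]; first by rewrite mulr0n add0r.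
have [y ye] : exists y, padded v k = nseq N b ++ y.
  by case: k {IH} => [|k]; eexists; rewrite /padded /= /pad -?catA; reflexivity.
rewrite /= -/(padded v k) mulrS -addrA -IH ye.
rewrite {1}/pad -!catA catA weighted_count_padl -catA -/pad.
by rewrite weighted_count_padr -addrA addrCA.
Qed.
End Padding.

End CountingFunctions.

(** * The free monoid *)

Lemma size_bound (T : eqType) (L : Type) (tw : T -> seq L) (s : seq T) :
  exists N, forall w, w \in s -> (size (tw w) <= N)%N.
Proof.
exists (\max_(w <- s) size (tw w))%N => w ws.
exact: (@leq_bigmax_seq _ s xpredT (fun w => size (tw w))).
Qed.

Section MonoidBasis.
Local Open Scope ring_scope.
Variables (K : numFieldType) (n : nat) (a : 'I_n).
Let word := monoid_word n.

Lemma pM_span (v : word) : span_mod (@pM K n) (W_M a) (pM K v).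
Proof.
pose P v := span_mod (fun w => count_fun K id w) (W_M a) (count_fun K id v).
rewrite -[span_mod _ _ _]/(P v).
have [m] := ubnP (size v); elim: m v => // m IH v vm.
(* A final [a] is eliminated first: this does not affect the initial letter. *)
have right u : (size u <= m)%N -> ~~ prefix [:: a] u -> P u.
  move=> um ua; have [ub|ub] := boolP (suffix [:: a] u); last first.
    by apply: (@spanned_gen K _ _ id).
  case/suffixP: ub um ua => {}u ->; rewrite cats1 size_rcons => um ua.
  apply: (@spanned_pivotr K _ _ id) => [|x xa]; first exact: IH.
  apply: (@spanned_gen K _ _ id); split.
    by case: u ua {um} => [|y u]; rewrite /= ?prefix0s ?andbT // eq_sym.
  by rewrite -cats1 /suffix rev_cat /= prefix0s andbT eq_sym.
have [va|va] := boolP (prefix [:: a] v); last exact: right.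
case/prefixP: va vm => {}v -> /= vm.
apply: (@spanned_pivotl K _ _ id) => [|x xa]; first exact: IH.
by apply: right; rewrite //= prefix0s andbT eq_sym.
Qed.

Lemma pM_indep : archimedean_norm K -> indep_mod (@pM K n) (W_M a).
Proof.
move=> arch s c us sW bnd.
have bnd' : bounded_fun (\sum_(w <- s) c w *: count_fun K id w) by [].
have occ_a k w : w \in s -> w != [::] -> occ w (nseq k a) = 0%N.
  by move=> /sW[wa _] w0; apply: occ_nseq_head.
have c0 : [::] \in s -> c [::] = 0.
  move=> s0.
  apply: (@coef_eq0_of_slope _ _ _ id s c arch bnd' _ (nseq^~ a)) => //.
    by move=> k; exists (nseq k a).
  move=> w k ws _; have [->|w0] := eqVneq w [::]; last exact: occ_a.
  by rewrite occ0 size_nseq mul1n.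
have [N sN] := size_bound id s.
have sP w : w \in s -> c w != 0 ->
    [/\ (0 < size w <= N)%N, ~~ prefix [:: a] w & ~~ suffix [:: a] w].
  move=> ws cw; have [? ?] := sW _ ws; split=> //.
  rewrite [X in _ && X]sN // andbT lt0n size_eq0.
  by apply: contraNneq cw => w0; rewrite w0 c0 // -w0.
(* The padding is a power of [a], where no word of [s] but the empty one
   occurs, so its own contribution vanishes. *)
have wc0 v : weighted_count id s c v = 0.
  have := @weighted_count_padded K _ _ id s c arch bnd' a a [::] N sP v.
  move=> /(_ (fun k => ex_intro _ _ erefl)); rewrite {1}/weighted_count.
  rewrite big_seq big1 ?add0r // => w ws.
  have [w0|w0] := eqVneq w [::]; first by rewrite w0 c0 ?mul0r // -w0.
  by rewrite /pad /= -nseqD occ_a ?mulr0.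
move=> w; have [m] := ubnP (size w); elim: m w => // m IH w wm ws.
have [->|cw] := eqVneq (c w) 0 => //.
have [/andP[w0 _] _ _] := sP w ws cw.
move: (wc0 w); rewrite /weighted_count (bigD1_seq w) //= occ_eq_size //.
rewrite eqxx mulr1 big_seq_cond big1 ?addr0 // => v /andP[vs vw].
have [vm|mv] := ltnP (size v) (size w).
  by rewrite IH ?mul0r // (leq_trans vm).
have [->|cv] := eqVneq (c v) 0; first by rewrite mul0r.
have [/andP[v0 _] _ _] := sP v vs cv.
by rewrite occ_eq_size // (negPf vw) mulr0.
Qed.
End MonoidBasis.

(** * Reduced words and their inverses *)

Section ReducedWords.
Variable n : nat.
Local Notation letter := (letter n).
Implicit Types (x y : letter) (v w : seq letter).

Lemma letter_inv_neq x : letter_inv x != x.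
Proof. by case: x => i []; rewrite /letter_inv xpair_eqE andbF. Qed.

Lemma letter_inv_inj : injective (@letter_inv n).
Proof. exact: (inv_inj (@letter_invK n)). Qed.

Lemma letter_inv_eq x y : (letter_inv x == y) = (x == letter_inv y).
Proof. by rewrite (can2_eq (@letter_invK n) (@letter_invK n)). Qed.

Lemma occ_nonreduced v w : reduced w -> ~~ reduced v -> occ v w = 0%N.
Proof.
move=> + vr; elim: w => [|a w IH] wr; first exact: occ_nil.
rewrite occ_cons (IH (path_sorted wr)) addn0; apply/eqP; rewrite eqb0.
apply: contra vr => /prefixP[s e].
by move: wr; rewrite /reduced e => /cat_sorted2[].
Qed.

Lemma reduced_cat v w : reduced v -> reduced w ->
  (forall x, v != [::] -> w != [::] -> head x w != letter_inv (last x v)) ->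
  reduced (v ++ w).
Proof.
case: v => // a v; case: w => [|b w]; first by rewrite cats0.
rewrite /reduced /= => av bw /(_ a isT isT) /= h.
by rewrite cat_path av /= h.
Qed.

Lemma reduced_nseq N x : reduced (nseq N x).
Proof.
case: N => // N; rewrite /reduced /=; elim: N => //= N ->.
by rewrite eq_sym letter_inv_neq.
Qed.

(** The letter [y] separates a power of [letter_inv x] from a power of [x]. *)
Lemma reduced_padded x y v N k : y != x -> y != letter_inv x ->
  reduced v -> v != [::] -> head x v != letter_inv x -> last x v != x ->
  reduced (padded x (letter_inv x) [:: y] N.+1 v k).
Proof.
move=> yx yix vr v0 hv lv.
have pr : reduced (pad x (letter_inv x) [:: y] N.+1).
  rewrite /pad; apply: reduced_cat; rewrite ?reduced_nseq //.
    apply: (@reduced_cat [:: y]); rewrite ?reduced_nseq // => z _ _ /=.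
    by rewrite eq_sym letter_inv_eq.
  move=> z _ _ /=.
  have -> : last (letter_inv x) (nseq N (letter_inv x)) = letter_inv x.
    by elim: N.
  by rewrite letter_invK.
elim: k => // k IH.
have hd z : head z (padded x (letter_inv x) [:: y] N.+1 v k) = letter_inv x.
  by case: k {IH}.
apply: reduced_cat; first exact: pr; last first.
  move=> z _ _; rewrite /pad /= last_cat /=.
  have -> : last x (nseq N x) = x by elim: N {pr IH hd} => //.
  by case: v v0 hv {vr lv hd IH}.
apply: reduced_cat => // z _ _; rewrite hd (inj_eq letter_inv_inj) eq_sym.
by case: v v0 lv {vr hv hd IH}.
Qed.

Lemma winvK : involutive (@winv n).
Proof.
move=> w; apply: val_inj; rewrite /= map_rev revK -map_comp map_id_in // => x _.
exact: letter_invK.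
Qed.

Lemma occ_winv (v u : group_word n) : occ (winv v) (winv u) = occ v u.
Proof. by rewrite occ_rev occ_map //; apply: letter_inv_inj. Qed.

(** In a word equal to its inverse, letters at opposite positions are inverse to
    each other; stripping the outermost pair ends with a letter that is its own
    inverse or with two adjacent inverse letters. *)
Lemma winv_neq (w : group_word n) : gword w != [::] -> winv w != w.
Proof.
move=> w0; apply/eqP => /(congr1 (@gword n)) /=.
have : reduced w by apply: gword_reduced.
have [m] := ubnP (size w); move: (gword w) w0 => {}w w0 sw.
elim: m w w0 sw => // m IH [|x w] // _; case/lastP: w => [|w y] /=.
  move=> _ _ [] /eqP; by rewrite (negPf (letter_inv_neq x)).
rewrite size_rcons => sw r.
rewrite map_rcons rev_cons rev_rcons /= -/(cat _ _).
case=> xy /rcons_inj[ww yx].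
case: (eqVneq w [::]) => [w0|w0].
  by move: r; rewrite w0 /reduced /= -yx eqxx.
apply: (IH w w0) => //; first by lia.
move: r; rewrite /reduced /= => /path_sorted; rewrite -cats1 => /cat_sorted2[].
by [].
Qed.

End ReducedWords.

(** * Spanning in the free group *)

Section GroupSpan.
Local Open Scope ring_scope.
Variables (K : numFieldType) (n : nat) (a1 a2 : letter n).
Hypothesis (a2i1 : a2 != letter_inv a1).
Local Notation inv := (@letter_inv n).
Local Notation q := (count_fun K (@gword n)).

Let spanned v := span_mod (@pF K n) (W_F a1 a2) (q v).

Definition good_left (v : seq (letter n)) :=
  ~~ prefix [:: a1] v && ~~ prefix [:: a2; inv a1] v.
Definition good_right (v : seq (letter n)) :=
  ~~ suffix [:: inv a1] v && ~~ suffix [:: a1; inv a2] v.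

Lemma spanned_nonreduced v : ~~ reduced v -> spanned v.
Proof.
move=> vr; apply: span_mod_bounded; exists 0 => w.
by rewrite /count_fun occ_nonreduced ?normr0 //; apply: gword_reduced.
Qed.

Lemma spanned_good v : v != [:: a2] -> good_left v -> good_right v -> spanned v.
Proof.
move=> va2 /andP[? ?] /andP[? ?].
have [vr|] := boolP (reduced v); last exact: spanned_nonreduced.
apply: (@spanned_gen K _ _ (@gword n) _ (GroupWord vr)); split; first by left.
by move=> /= [] e; rewrite e eqxx in va2.
Qed.

(** In front of [y] the letter to eliminate is [a1], or [a2] if [a1] would
    cancel against [y]. *)
Lemma good_left_cons2 x y t : reduced (x :: y :: t) ->
  x != (if y == inv a1 then a2 else a1) -> good_left (x :: y :: t).
Proof.
rewrite /good_left /reduced /= !prefix0s !andbT => /andP[yx _].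
have [e|yn] := eqVneq y (inv a1); last by rewrite andbF andbT eq_sym.
rewrite !(eq_sym _ x) => /negPf ->; rewrite /= andbT.
by apply: contraNneq yx => ->; rewrite e.
Qed.

Lemma good_right_rcons2 t x y : reduced (rcons (rcons t x) y) ->
  y != (if x == a1 then inv a2 else inv a1) -> good_right (rcons (rcons t x) y).
Proof.
rewrite /good_right /suffix !rev_rcons /= !prefix0s !andbT => r.
have yx : y != inv x.
  by move: r; rewrite /reduced -rev_sorted !rev_rcons /= => /andP[].
have [e|xn] := eqVneq x a1; last by rewrite andbF andbT eq_sym.
rewrite !(eq_sym _ y) => /negPf ->; rewrite /= andbT.
by apply: contraNneq yx => ->; rewrite e.
Qed.

Lemma spanned_empty : spanned [::].
Proof. exact: spanned_good. Qed.

Lemma spanned_pair x y : x != a1 -> y != inv a1 -> spanned [:: x; y].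
Proof.
move=> xa ya.
apply: spanned_good => //; rewrite /good_left /good_right /suffix /=.
  by rewrite eqseq_cons andbF.
  by rewrite !(eq_sym _ x) (negPf xa) !(eq_sym _ y) (negPf ya) !andbF.
by rewrite !(eq_sym _ x) (negPf xa) !(eq_sym _ y) (negPf ya) !andbF.
Qed.

Lemma spanned_letter x : x != a1 -> x != a2 -> spanned [:: x].
Proof.
move=> x1 x2; have [->|xi] := eqVneq x (inv a1).
  apply: (@spanned_gen K _ _ (@gword n) _ (letter_gword (inv a1))).
  split; first by right.
  by move=> [] e; move: a2i1; rewrite e eqxx.
apply: spanned_good; rewrite /good_left /good_right /suffix /= ?andbF ?andbT //.
- by rewrite eqseq_cons andbT.
- by rewrite eq_sym.
- by rewrite eq_sym.
Qed.

(** Eliminating [a1] by [p_eps ~ \sum_x p_x] requires the sum of the [p_x] with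
    [x <> a1]. Extending these [x] to the right gives words [x y] that are in
    the index set unless [y] is [inv a1]; the exceptional words [x (inv a1)] are
    all the reduced left extensions of [inv a1], so they add up to
    [p_(inv a1)]. *)
Lemma spanned_a1 : spanned [:: a1].
Proof.
have extl v : span_mod (@pF K n) (W_F a1 a2) (q v - \sum_x q (x :: v)).
  exact/span_mod_bounded/bounded_count_ext/occ_extl.
have extr v : span_mod (@pF K n) (W_F a1 a2) (q v - \sum_x q (rcons v x)).
  exact/span_mod_bounded/bounded_count_ext/occ_extr.
have split1 b (F : letter n -> group_word n -> K^o) (f : group_word n -> K^o) :
    f - (f - \sum_x F x) - F b = \sum_(x | x != b) F x.
  by rewrite (bigD1 b) //= opprB addrCA subrr addr0 addrAC subrr add0r.
suff sum_spanned : span_mod (@pF K n) (W_F a1 a2) (\sum_(x | x != a1) q [:: x]).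
  rewrite /spanned -[q _]opprK.
  rewrite -[X in - X](addKr (q [::] - (q [::] - \sum_x q [:: x]))).
  rewrite [_ + - q _](split1 a1) opprD opprK.
  apply: span_modD; last exact: span_modN.
  apply: span_modD; first exact: spanned_empty.
  exact/span_modN/extl.
rewrite -(eq_bigr _ (fun x _ => subrK (\sum_y q [:: x; y]) (q [:: x]))).
rewrite big_split /=.
apply: span_modD; first by apply: span_mod_sum => x _; apply: (extr [:: x]).
under eq_bigr do rewrite (bigD1 (inv a1)) //=.
rewrite big_split /=; apply: span_modD; last first.
  apply: span_mod_sum => x xa; apply: span_mod_sum => y ya.
  exact: spanned_pair.
rewrite -(split1 a1 _ (q [:: inv a1])); apply: span_modD.
  apply: span_modD; last exact/span_modN/extl.
  by apply: spanned_letter; rewrite ?letter_inv_neq // eq_sym.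
apply/span_modN/spanned_nonreduced.
by rewrite /reduced /= eqxx.
Qed.

Lemma spanned_size1 x : spanned [:: x].
Proof.
have [->|x1] := eqVneq x a1; first exact: spanned_a1.
have [->|x2] := eqVneq x a2; last exact: spanned_letter.
apply: (@spanned_pivotl K _ _ (@gword n)) => [|y y2].
  exact: spanned_empty.
have [->|y1] := eqVneq y a1; first exact: spanned_a1.
exact: spanned_letter.
Qed.

Lemma count_fun_span v : spanned v.
Proof.
have [m] := ubnP (size v); elim: m v => // m IH v vm.
(* From length 3 on, changing the first letter leaves the right end alone. *)
have right u : (2 < size u <= m)%N -> good_right u -> spanned u.
  case: u => [|x [|y [|z t]]] //= um ur.
  pose l := if y == inv a1 then a2 else a1.
  have lP x' : x' != l -> spanned [:: x', y, z & t].
    move=> xl; have [r|] := boolP (reduced [:: x', y, z & t]); last first.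
      exact: spanned_nonreduced.
    apply: spanned_good; first by rewrite eqseq_cons andbF.
      exact: (good_left_cons2 r xl).
    by move: ur; rewrite /good_right !suffixE.
  have [->|] := eqVneq x l; last exact: lP.
  by apply: (@spanned_pivotl K _ _ (@gword n)) => //; apply: IH.
have [v3|v3] := leqP 3 (size v).
  move: v3 vm; case/lastP: v => // v y; case/lastP: v => // v x.
  rewrite !size_rcons => v3 vm.
  pose l := if x == a1 then inv a2 else inv a1.
  have lP y' : y' != l -> spanned (rcons (rcons v x) y').
    move=> yl; have [r|] := boolP (reduced (rcons (rcons v x) y')); last first.
      exact: spanned_nonreduced.
    apply: right; last exact: (good_right_rcons2 r yl).
    by rewrite !size_rcons; apply/andP.
  have [->|] := eqVneq y l; last exact: lP.
  apply: (@spanned_pivotr K _ _ (@gword n)) => //; apply: IH.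
  by rewrite size_rcons.
case: v v3 {vm} => [|x [|y [|]]] // _.
- exact: spanned_empty.
- exact: spanned_size1.
have [->|ya] := eqVneq y (inv a1).
  have [->|xa] := eqVneq x a1.
    by apply: spanned_nonreduced; rewrite /reduced /= eqxx.
  apply: (@spanned_pivotr K _ _ (@gword n) _ [:: x]) => [|z za].
    exact: spanned_size1.
  exact: spanned_pair.
have [->|xa] := eqVneq x a1; last exact: spanned_pair.
apply: (@spanned_pivotl K _ _ (@gword n)) => [|z za].
  exact: spanned_size1.
exact: spanned_pair.
Qed.

End GroupSpan.

(** * Independence in the free group *)

Section GroupIndep.
Local Open Scope ring_scope.
Variables (K : numFieldType) (n : nat) (a1 a2 : letter n).
Hypothesis (a21 : a2 != a1) (a2i1 : a2 != letter_inv a1).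
Local Notation inv := (@letter_inv n).
Hypothesis arch : archimedean_norm K.
Variables (s : seq (group_word n)) (c : group_word n -> K).
Hypothesis us : uniq s.
Hypothesis bnd : bounded_fun (\sum_(w <- s) c w *: pF K w).
Local Notation wc := (weighted_count (@gword n) s c).

Lemma letter_power_word x (k : nat) :
  exists w : group_word n, gword w = nseq k x.
Proof. by exists (GroupWord (reduced_nseq k x)). Qed.

Lemma coef_eq0_of_power w0 x : w0 \in s ->
  (forall w k, w \in s -> c w != 0 -> occ w (nseq k x) = ((w == w0) * k)%N) ->
  c w0 = 0.
Proof.
move=> ws.
apply: (@coef_eq0_of_slope _ _ _ (@gword n) s c arch bnd _ (nseq^~ x) us ws).
by move=> k; apply: letter_power_word.
Qed.

Hypothesis sW : forall w, w \in s -> c w != 0 ->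
  W_F' a1 a2 w /\ gword w != [::].

Lemma wc_padded : exists C, forall v, reduced v -> v != [::] ->
  head a1 v != inv a1 -> last a1 v != a1 -> C + wc v = 0.
Proof.
have [N sN] := size_bound (@gword n) s.
exists (wc (pad a1 (inv a1) [:: a2] N.+1)) => v vr v0 hv lv.
apply: (@weighted_count_padded K _ _ (@gword n) s c arch bnd).
  move=> w ws cw; have [[wa _ wi _] w0] := sW ws cw; split=> //.
  by rewrite lt0n size_eq0 w0 (leq_trans (sN _ ws)).
move=> k.
by exists (GroupWord (reduced_padded N k a21 a2i1 vr v0 hv lv)).
Qed.

Lemma prefix_pair (x y : letter n) (v t : seq (letter n)) :
  (1 < size v)%N -> prefix v [:: x, y & t] -> prefix [:: x; y] v.
Proof.
case: v => [|u [|z v]] //= _; rewrite prefix0s andbT.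
by rewrite [x == _]eq_sym [y == _]eq_sym => /and3P[-> ->].
Qed.

(** If [w] starts with [inv a1], shielding it by [a2] creates the initial pair
    [a2], [inv a1], with which [v] does not start. *)
Lemma occ_pad_left (v : seq (letter n)) (w : seq (letter n)) r :
  (1 < size v)%N -> ~~ prefix [:: a2; inv a1] v ->
  occ v ((if prefix [:: inv a1] w then [:: a2] else [::]) ++ w ++ r) =
  occ v (w ++ r).
Proof.
move=> v2 va; case: ifP => // /prefixP[t ->].
rewrite /= occ_cons; case: (boolP (prefix _ _)) => // /(prefix_pair v2).
by rewrite (negPf va).
Qed.

Lemma occ_pad_right (v : seq (letter n)) (w : seq (letter n)) :
  (1 < size v)%N -> ~~ suffix [:: a1; inv a2] v ->
  occ v (w ++ (if suffix [:: a1] w then [:: inv a2] else [::])) = occ v w.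
Proof.
move=> v2 va; case: ifP => [/suffixP[t ->]|_]; last by rewrite cats0.
rewrite cats1 occ_rcons; case: (boolP (suffix _ _)) => //; rewrite ?addn0 //.
rewrite /suffix rev_rcons rev_cat /= => /prefix_pair.
rewrite size_rev => /(_ v2) h; by move: va; rewrite /suffix h.
Qed.

(** The hypothesis on the values at [a2] and [inv a2] makes the contribution [C]
    of the padding vanish, since [C + wc [:: a2] = C + wc [:: inv a2] = 0]. The
    coefficients then vanish by induction on the length. Words of length 1 come
    first and need no shielding; this matters because the shielding letter
    [inv a2] may itself belong to the family. *)
Lemma coef_eq0_of_padding : wc [:: a2] = 0 \/ wc [:: a2] + wc [:: inv a2] = 0 ->
  forall w, w \in s -> c w = 0.
Proof.
move=> h2; have [C wcC] := wc_padded.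
have C2 : C + wc [:: a2] = 0 by apply: wcC => //=.
have C2i : C + wc [:: inv a2] = 0.
  apply: wcC => //=; first by rewrite (inj_eq (@letter_inv_inj n)).
  by rewrite letter_inv_eq.
have C0 : C = 0.
  case: h2 => h2; first by rewrite -C2 h2 addr0.
  have : C *+ 2 = (C + wc [:: a2]) + (C + wc [:: inv a2]).
    by rewrite addrACA h2 addr0.
  rewrite C2 C2i addr0.
  by move/eqP; rewrite mulrn_eq0 => /eqP.
move=> w; have [m] := ubnP (size w); elim: m w => // m IH w wm ws.
have [->|cw] := eqVneq (c w) 0 => //.
have [[wa waa wi wii] w0] := sW ws cw.
pose v := (if prefix [:: inv a1] w then [:: a2] else [::]) ++ w ++
  (if suffix [:: a1] w then [:: inv a2] else [::]).
have vC : C + wc v = 0.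
  have vw := gword_reduced w; have lw : suffix [:: a1] w = (last a2 w == a1).
    case/lastP: (gword w) w0 => // t x _.
    by rewrite /suffix rev_rcons /= prefix0s andbT last_rcons eq_sym.
  have hw : prefix [:: inv a1] w = (head a1 w == inv a1).
    by case: (gword w) w0 => //= x t _; rewrite prefix0s andbT eq_sym.
  have w0' t : gword w ++ t != [::] by case: (gword w) w0.
  have hwt x y t : head x (gword w ++ t) = head y w by case: (gword w) w0.
  have lwx x y : last x w = last y w by case: (gword w) w0.
  apply: wcC; rewrite /v.
  - apply: reduced_cat => [||x p0 _]; first by case: ifP.
      apply: reduced_cat => // [|x _]; first by case: ifP.
      rewrite lw (lwx x a2); case: (_ =P a1) => [-> _|_ //].
      by rewrite /= (inj_eq (@letter_inv_inj n)).
    rewrite (hwt _ a1); move: p0; rewrite hw.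
    case: (_ =P inv a1) => [-> _ /=|_ //].
    by rewrite (inj_eq (@letter_inv_inj n)) eq_sym.
  - by case: ifP => // _; apply: w0'.
  - rewrite hw; case: (eqVneq (head a1 w) (inv a1)) => //= h.
    by rewrite (hwt _ a1).
  - rewrite !last_cat lw; case: (eqVneq (last a2 w) a1) => [_|] /=.
      by rewrite letter_inv_eq.
    by rewrite (lwx _ a2).
move: vC; rewrite C0 add0r /weighted_count (bigD1_seq w) //=.
have occv x : x \in s -> c x != 0 -> occ x v = (x == w).
  move=> xs cx; have [[xa xaa xi xii] x0] := sW xs cx.
  have wx : (size w <= size x)%N.
    by rewrite leqNgt; apply: contra cx => xw; rewrite IH // (leq_trans xw).
  have xw : occ x w = (x == w).
    by rewrite occ_eq_size // lt0n size_eq0.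
  have [x1|x1] := ltnP 1 (size x).
    by rewrite /v occ_pad_left // occ_pad_right.
  rewrite -xw /v; congr occ.
  case: (gword w) w0 wa wi (leq_trans wx x1) => [|y []] //= _.
  rewrite /suffix /= !andbT => /negPf ya /negPf yi _.
  by rewrite ya yi.
rewrite occv // eqxx mulr1 big_seq_cond big1 ?addr0 // => x /andP[xs xw].
have [->|cx] := eqVneq (c x) 0; first by rewrite mul0r.
by rewrite occv // (negPf xw) mulr0.
Qed.

End GroupIndep.

Section GroupBasis.
Local Open Scope ring_scope.
Variables (K : numFieldType) (n : nat) (a1 a2 : letter n).
Hypothesis (a21 : a2 != a1) (a2i1 : a2 != letter_inv a1).
Local Notation inv := (@letter_inv n).
Hypothesis arch : archimedean_norm K.

Lemma pF_span w : span_mod (@pF K n) (W_F a1 a2) (pF K w).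
Proof. exact: (count_fun_span K a2i1 w). Qed.

Lemma pF_indep : indep_mod (@pF K n) (W_F a1 a2).
Proof.
move=> s c us sW bnd; pose e := empty_gword n; pose b := letter_gword (inv a1).
have nil_e (w : group_word n) : w != e -> gword w != [::].
  by apply: contra => /eqP w0; apply/eqP/val_inj.
have ce : e \in s -> c e = 0.
  move=> es; apply: (coef_eq0_of_power arch us bnd es (x := a1)) => w k ws _.
  have [->|we] := eqVneq w e; first by rewrite occ0 size_nseq mul1n.
  rewrite mul0n; apply: occ_nseq_head; first exact: nil_e.
  have [[[]//|/= ->] _] := sW _ ws.
  by rewrite /= andbT eq_sym letter_inv_neq.
have cb : b \in s -> c b = 0.
  move=> bs.
  apply: (coef_eq0_of_power arch us bnd bs (x := inv a1)) => w k ws cw.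
  have [->|wb] := eqVneq w b; first by rewrite occ_letter_power mul1n.
  have we : w != e by apply: contraNneq cw => we; rewrite we ce // -we.
  rewrite mul0n; apply: occ_nseq_last; first exact: nil_e.
  have [[[]//|/= wb'] _] := sW _ ws.
  by rewrite wb' eqxx in wb.
have sP w : w \in s -> c w != 0 -> W_F' a1 a2 w /\ gword w != [::].
  move=> ws cw; split.
    have [[//|/= wb] _] := sW _ ws.
    by move: cw; rewrite wb cb ?eqxx // -[b]wb.
  by apply: nil_e; apply: contraNneq cw => we; rewrite we ce // -we.
apply: (coef_eq0_of_padding a21 a2i1 arch us bnd sP); left.
rewrite /weighted_count big_seq big1 // => w ws.
have [->|cw] := eqVneq (c w) 0; first by rewrite mul0r.
have [_ w0] := sP w ws cw; rewrite occ_eq_size ?lt0n ?size_eq0 //.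
have [wa|_] := eqVneq; last by rewrite mulr0.
by have [_ []] := sW _ ws; apply: val_inj.
Qed.

Lemma W_F'_winv w : W_F' a1 a2 w -> W_F' a1 a2 (winv w).
Proof.
have pre (u v : seq (letter n)) : prefix (map inv u) (map inv v) = prefix u v.
  elim: u v => [|x u IH] [|y v] //=.
  by rewrite IH (inj_eq (@letter_inv_inj n)).
have suf u v : suffix (rev (map inv u)) (rev (map inv v)) = prefix u v.
  by rewrite suffix_rev pre.
have pre' u v : prefix (rev (map inv u)) (rev (map inv v)) = suffix u v.
  by rewrite -!map_rev pre.
have i1 := letter_invK a1; have i2 := letter_invK a2.
case=> h1 h2 h3 h4; split.
- by move: h3; rewrite -pre' /= i1.
- by move: h4; rewrite -pre' /= i2.
- by move: h1; rewrite -suf.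
- by move: h2; rewrite -suf /= i1.
Qed.

(** * Brooks functions *)

Section Brooks.
Variable W_Br : set (group_word n).
Hypothesis Br_sub : W_Br `<=` W_Br' a1 a2.
Hypothesis Br_or : forall w, W_Br' a1 a2 w -> W_Br w \/ W_Br (winv w).
Hypothesis Br_excl : forall w, W_Br w -> ~ W_Br (winv w).

Lemma brooks_winv (w : group_word n) : brooks K (winv w) = - brooks K w.
Proof. by rewrite /brooks winvK opprB. Qed.

Lemma brooks_span_W_F w :
  W_F a1 a2 w -> span_mod (@brooks K n) W_Br (brooks K w).
Proof.
move=> Ww; have [we|we] := eqVneq w (empty_gword n).
  have -> : brooks K w = 0; last exact: span_mod0.
  rewrite /brooks (_ : winv w = w) ?subrr // we.
  exact: val_inj.
have /Br_or[] : W_Br' a1 a2 w by split; [left|apply/eqP].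
  exact: span_mod_gen.
move=> Wi; rewrite -[w]winvK brooks_winv.
by apply/span_modN/span_mod_gen.
Qed.

(** Antisymmetrization carries the expression of [pF w] over the basis of
    counting functions to one of [brooks w]. *)
Lemma brooks_span_mod w : span_mod (@brooks K n) W_Br (brooks K w).
Proof.
pose anti (f : group_word n -> K^o) : group_word n -> K^o :=
  fun u => f u - f (winv u).
have antip v : anti (pF K v) = brooks K v.
  apply/funext => u; apply: (congr1 (fun y => pF K v u - y)).
  by rewrite /pF -occ_winv winvK.
have [h [r rW hr] [M wh]] := pF_span w.
have ah : span_mod (@brooks K n) W_Br (anti h).
  have -> : anti h = \sum_(x <- r) x.1 *: anti x.2.
    rewrite hr /anti; apply/funext => u.
    rewrite !fct_sumE -sumrB; apply: eq_bigr => x _.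
    exact: esym (scalerBr _ _ _).
  rewrite big_seq; apply: span_mod_sum => x /rW[v Wv <-].
  by apply: span_modZ; rewrite antip; apply: brooks_span_W_F.
apply: span_mod_congr ah; exists (M + M) => u.
rewrite -antip.
rewrite [X in `|X|](_ : _ = (pF K w - h) u - (pF K w - h) (winv u)).
  by rewrite (le_trans (ler_normB _ _)) // lerD.
rewrite -[LHS]/(pF K w u - pF K w (winv u) - (h u - h (winv u))).
rewrite -[RHS]/(pF K w u - h u - (pF K w (winv u) - h (winv u))).
by rewrite !opprB addrACA [RHS]addrACA [- _ - _]addrC.
Qed.

(** A combination of Brooks functions is turned into one of counting functions
    over [s'], the disjoint union of [s] and its inverses, with coefficients [d]
    odd under inversion. *)
Lemma brooks_indep : indep_mod (@brooks K n) W_Br.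
Proof.
move=> s c us sW bnd.
pose d w := if w \in s then c w else - c (winv w).
pose s' := s ++ map (@winv n) s.
have winv_s w : w \in s -> winv w \notin s.
  by move=> /sW Ww; apply/negP => /sW; apply: Br_excl.
have sE (V : lmodType K) (F : group_word n -> V) :
    \sum_(w <- s') d w *: F w = \sum_(w <- s) c w *: (F w - F (winv w)).
  rewrite big_cat big_map /= -big_split /= !big_seq; apply: eq_bigr => w ws.
  by rewrite /d ws (negPf (winv_s w ws)) winvK scaleNr scalerBr.
have us' : uniq s'.
  rewrite cat_uniq us map_inj_uniq ?us; last exact: inv_inj (@winvK n).
  rewrite andbT; apply/hasPn => _ /mapP[w ws ->]; exact: winv_s.
have bnd' : bounded_fun (\sum_(w <- s') d w *: pF K w) by rewrite sE.
pose P w := gword w != [::] /\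
  (W_F' a1 a2 w \/ w = letter_gword a1 \/ w = letter_gword (inv a1)).
have PW w : W_Br' a1 a2 w -> P w.
  case=> Ww we; split.
    by apply: contra_notN we => /eqP w0; apply: val_inj.
  case: Ww => [[[]]|[]->]; [by left|by right; right|by right; left|left].
  by split; rewrite /suffix /= ?andbF ?andbT // eq_sym.
have Pinv w : P w -> P (winv w).
  case=> w0 Pw; split; first by rewrite -size_eq0 size_rev size_map size_eq0.
  case: Pw => [/W_F'_winv|[|]->]; [by left|right; right|right; left].
    exact: val_inj.
  by apply: val_inj; rewrite /= letter_invK.
have s'P w : w \in s' -> P w.
  by rewrite mem_cat => /orP[/sW/Br_sub/PW//|/mapP[v /sW/Br_sub/PW/Pinv Pv ->]].
have d1 x : x = a1 \/ x = inv a1 ->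
    letter_gword x \in s' -> d (letter_gword x) = 0.
  move=> xa xs.
  apply: (coef_eq0_of_power arch us' bnd' xs (x := x)) => w k ws _.
  have [->|wx] := eqVneq w (letter_gword x).
    by rewrite occ_letter_power mul1n.
  have [w0 Pw] := s'P w ws; rewrite mul0n.
  have occ_letter y : w = letter_gword y -> occ w (nseq k x) = 0%N.
    move=> wy; apply: occ_nseq_head => //; apply: contra wx.
    by rewrite wy /= andbT => /eqP->.
  case: Pw => [[h _ h' _]|[]]; try exact: occ_letter.
  by case: xa => ->; [apply: occ_nseq_head|apply: occ_nseq_last].
have s'W w : w \in s' -> d w != 0 -> W_F' a1 a2 w /\ gword w != [::].
  move=> ws dw; have [w0 [//|w1]] := s'P w ws; split=> //.
  by case: w1 dw ws => -> /[swap] /d1 -> //; rewrite ?eqxx; auto.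
have d0 := coef_eq0_of_padding a21 a2i1 arch us' bnd' s'W.
move=> w ws; have: d w = 0; last by rewrite /d ws.
apply: d0; last by rewrite mem_cat ws.
(* The values of an odd combination at [a2] and [inv a2] are opposite. *)
right; have wE u : weighted_count (@gword n) s' d u =
    \sum_(w <- s) c w * ((occ w u)%:R - (occ (winv w) u)%:R).
  exact: (sE K^o (fun w => (occ w u)%:R)).
rewrite !wE -big_split /= big1 // => v _; rewrite -mulrDr.
have -> : occ v [:: inv a2] = occ (winv v) [:: a2].
  by rewrite -(occ_winv v (letter_gword (inv a2))) /= letter_invK.
have -> : occ (winv v) [:: inv a2] = occ v [:: a2].
  by rewrite -(occ_winv v (letter_gword a2)).
by rewrite addrC subrKA subrr mulr0.
Qed.
End Brooks.
End GroupBasis.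

(** * The scalar fields, and the theorem *)

Section Archimedean.
Local Open Scope ring_scope.

Lemma archi_mulrn_le (F : archiRealFieldType) (x M : F) :
  (forall k, `|x| *+ k <= M) -> x = 0.
Proof.
move=> xM; apply/eqP/negPn/negP; rewrite -normr_gt0 => x0.
have M0 : 0 <= M by have := xM 0%N; rewrite mulr0n.
have := archi_boundP (divr_ge0 M0 (ltW x0)); set k := Num.bound _.
by rewrite ltr_pdivrMr // mulr_natl ltNge xM.
Qed.

(** The bound [M] of the complex case is comparable to a real number, hence
    real itself; comparing real parts reduces the claim to the real case. *)
Lemma scalar_field_archimedean (R : realType) (k : scalars) :
  archimedean_norm (scalar_field R k).
Proof.
case: k => /= x M xM; [exact: archi_mulrn_le xM|exact: archi_mulrn_le xM|].
apply/eqP; rewrite -normr_eq0 normc_def; apply/eqP; congr (_%:C)%C.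
apply: (@archi_mulrn_le R _ (complex.Re M)) => m.
have := xM m; rewrite normc_def -raddfMn lecE /= => /andP[_].
by rewrite ger0_norm // sqrtr_ge0.
Qed.
End Archimedean.

Lemma card_pair_inv (n : nat) (w : group_word n) (B : set (group_word n)) :
  gword w != [::] -> [set w; winv w] `&` B #= `I_1 ->
  (B w \/ B (winv w)) /\ ~ (B w /\ B (winv w)).
Proof.
move=> w0 /card_set_bijP[f [fun_f inj_f surj_f]]; split.
  have [v [vw Bv] _] : [set f v | v in [set w; winv w] `&` B] 0%N.
    exact: surj_f.
  by case: vw Bv => ->; [left|right].
move=> [Bw Bwi]; have /eqP[] := winv_neq w0.
have Aw : ([set w; winv w] `&` B) w by split; [left|].
have Awi : ([set w; winv w] `&` B) (winv w) by split; [right|].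
have f0 v : ([set w; winv w] `&` B) v -> f v = 0%N.
  by move=> /fun_f /=; case: (f v).
by apply: inj_f; rewrite ?inE // !f0.
Qed.

Theorem theorem1p5 (R : realType) (k : scalars) (n : nat) (hn : (1 < n)%N) :
  let K : numFieldType := scalar_field R k in
  let i1 : 'I_n := Ordinal (ltnW hn) in
  let i2 : 'I_n := Ordinal hn in
  let a1 : letter n := (i1, false) in
  let a2 : letter n := (i2, false) in
  [/\ is_indexed_basis (W_M i1) (@hat_pM K n),
      is_indexed_basis (W_F a1 a2) (@hat_pF K n) &
      forall W_Br : set (group_word n),
        W_Br `<=` W_Br' a1 a2 ->
        (forall w, W_Br' a1 a2 w -> [set w; winv w] `&` W_Br #= `I_1) ->
        is_indexed_basis W_Br (@hat_brooks K n)].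
Proof.
move=> K i1 i2 a1 a2.
have arch := @scalar_field_archimedean R k.
have a21 : a2 != a1 by [].
have a2i1 : a2 != letter_inv a1 by [].
split.
- apply: indep_span_mod_basis; first exact: pM_indep.
  by move=> _ [v _ <-]; apply: pM_span.
- apply: indep_span_mod_basis; first exact: pF_indep.
  by move=> _ [v _ <-]; apply: pF_span.
- move=> W_Br Br_sub Br_card.
  have W_Br'_neq0 w : W_Br' a1 a2 w -> gword w != [::].
    by move=> [_ we]; apply: contra_notN we => /eqP w0; apply: val_inj.
  apply: indep_span_mod_basis.
    apply: (brooks_indep a21 a2i1 arch Br_sub) => w Ww Wiw.
    have W'w := Br_sub w Ww.
    by have [_] := card_pair_inv (W_Br'_neq0 w W'w) (Br_card w W'w); apply.
  move=> _ [w _ <-]; apply: (@brooks_span_mod _ n a1 a2 a2i1) => v W'v.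
  by have [] := card_pair_inv (W_Br'_neq0 v W'v) (Br_card v W'v).
Qed.
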